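(* Let $n$ be even, let $A$ be a real $m\times n$ matrix and $B$ a real $n\times\rho$ matrix, and let $c\ge1$ be a fixed sample size. Assume the probability $p^{(o)}=(p^{(o)}_\ell)_{\ell=1}^n$, $$p^{(o)}_\ell=\frac{\|A_{(,\ell)}\|_F\|B_{(\ell,)}\|_F}{\sum_{j=1}^n\|A_{(,j)}\|_F\|B_{(j,)}\|_F},$$ has all entries positive. Let $I:\{1,\ldots,n\}\to\{1,\ldots,n\}$ be any bijection, written $I_\ell=I(\ell)$, and set $p^{(\text{pair})}_j=p^{(o)}_{I_{2j-1}}+p^{(o)}_{I_{2j}}$ for $1\le j\le\frac n2$. Let $\hat S$ be the output of the pairwise-partition sampling algorithm, $$\hat S=\frac1c\sum_{i=1}^c\frac1{p^{(\text{pair})}_{r_i}}A_{(,\{I_{2r_i-1},I_{2r_i}\})}B_{(\{I_{2r_i-1},I_{2r_i}\},)},$$ where $r_1,\ldots,r_c$ are independent samples from $\{1,\ldots,\frac n2\}$ drawn according to $p^{(\text{pair})}$. Then $$\mathbb{E}_{p^{(\text{pair})}}\big[\|AB-\hat S\|_F^2\big]\le V_{p^{(o)}}(AB).$$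
   Context: $A_{(,\ell)}$ is the $\ell$th column of $A$ and $B_{(\ell,)}$ the $\ell$th row of $B$; for an index set $J$, $A_{(,J)}$ is the matrix formed by the columns of $A$ with indices in $J$ and $B_{(J,)}$ the matrix formed by the rows of $B$ with indices in $J$ (same ordering). $\|\cdot\|_F$ is the Frobenius norm. $V_{p^{(o)}}(AB)$ is the expected squared Frobenius error of single-column sampling with probability $p^{(o)}$, i.e. $V_{p^{(o)}}(AB)=\mathbb{E}_{p^{(o)}}\big[\|AB-\frac1c\sum_{i=1}^c\frac1{p^{(o)}_{t_i}}A_{(,t_i)}B_{(t_i,)}\|_F^2\big]$ with $t_1,\ldots,t_c$ independent samples from $\{1,\ldots,n\}$ drawn according to $p^{(o)}$; equivalently $$V_{p^{(o)}}(AB)=\frac1c\Big(\sum_{\ell=1}^n\|A_{(,\ell)}\|_F\|B_{(\ell,)}\|_F\Big)^2-\frac{\|AB\|_F^2}{c}.$$ *)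

(* Defs.v *)
From mathcomp Require Import all_boot all_order all_algebra.
From mathcomp Require Import reals.

Set Implicit Arguments.
Unset Strict Implicit.
Unset Printing Implicit Defensive.

Import Order.TTheory GRing.Theory Num.Theory.
Local Open Scope ring_scope.

Definition frob (R : realType) (m n : nat) (M : 'M[R]_(m, n)) : R :=
  Num.sqrt (\sum_(i < m) \sum_(j < n) M i j ^+ 2).

Definition colset (R : realType) (m n : nat) (J : {set 'I_n})
    (A : 'M[R]_(m, n)) : 'M[R]_(m, #|J|) :=
  colsub (fun k : 'I_#|J| => enum_val k) A.

Definition rowset (R : realType) (n q : nat) (J : {set 'I_n})
    (B : 'M[R]_(n, q)) : 'M[R]_(#|J|, q) :=
  rowsub (fun k : 'I_#|J| => enum_val k) B.

(* Expectation of X (t_1, ..., t_c) for independent t_1, ..., t_c with common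
   law p on T: the joint law of the sample is the product law. *)
Definition iid_expect (R : realType) (T : finType) (c : nat) (p : T -> R)
    (X : {ffun 'I_c -> T} -> R) : R :=
  \sum_(t : {ffun 'I_c -> T}) (\prod_(i < c) p (t i)) * X t.

Definition popt (R : realType) (m n q : nat)
    (A : 'M[R]_(m, n)) (B : 'M[R]_(n, q)) (l : 'I_n) : R :=
  frob (col l A) * frob (row l B) /
    \sum_(j < n) frob (col j A) * frob (row j B).

Definition single_est (R : realType) (m n q c : nat) (p : 'I_n -> R)
    (A : 'M[R]_(m, n)) (B : 'M[R]_(n, q)) (t : {ffun 'I_c -> 'I_n}) :
    'M[R]_(m, q) :=
  c%:R^-1 *: \sum_(i < c) (p (t i))^-1 *: (col (t i) A *m row (t i) B).

Definition single_err (R : realType) (m n q c : nat) (p : 'I_n -> R)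
    (A : 'M[R]_(m, n)) (B : 'M[R]_(n, q)) : R :=
  iid_expect p (fun t : {ffun 'I_c -> 'I_n} =>
    frob (A *m B - single_est p A B t) ^+ 2).

Lemma pair_snd_subproof (n : nat) (j : 'I_n./2) : (j.*2.+1 < n)%N.
Proof. by rewrite -doubleS -geq_half_double. Qed.

Lemma pair_fst_subproof (n : nat) (j : 'I_n./2) : (j.*2 < n)%N.
Proof. exact: ltnW (pair_snd_subproof j). Qed.

(* With indices starting at 0, the j-th pair of positions is {2j, 2j+1}. *)
Definition pair_fst (n : nat) (j : 'I_n./2) : 'I_n :=
  Ordinal (pair_fst_subproof j).
Definition pair_snd (n : nat) (j : 'I_n./2) : 'I_n :=
  Ordinal (pair_snd_subproof j).

Definition ppair (R : realType) (n : nat) (I : 'I_n -> 'I_n) (p : 'I_n -> R)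
    (j : 'I_n./2) : R :=
  p (I (pair_fst j)) + p (I (pair_snd j)).

Definition pair_set (n : nat) (I : 'I_n -> 'I_n) (j : 'I_n./2) : {set 'I_n} :=
  [set I (pair_fst j); I (pair_snd j)].

Definition pair_est (R : realType) (m n q c : nat) (I : 'I_n -> 'I_n)
    (p : 'I_n -> R) (A : 'M[R]_(m, n)) (B : 'M[R]_(n, q))
    (r : {ffun 'I_c -> 'I_n./2}) : 'M[R]_(m, q) :=
  c%:R^-1 *: \sum_(i < c) (ppair I p (r i))^-1 *:
    (colset (pair_set I (r i)) A *m rowset (pair_set I (r i)) B).

(* Main.v *)
Require Import Defs.
From mathcomp Require Import all_boot all_order all_algebra.
From mathcomp Require Import reals.
From mathcomp Require Import ring.

Import Order.TTheory GRing.Theory Num.Theory.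
Local Open Scope ring_scope.

(** Both estimators are sample means of independent unbiased estimates of
    [A *m B], and the squared Frobenius norm is a sum over entries, so the
    comparison can be made one entry at a time between scalar sample means.
    The mean squared error of a sample mean is [c^-1] times the variance of a
    single draw ([iid_expect_sample_mean]), so it is enough to compare the
    variances of single draws.

    Drawing a pair instead of an index replaces the values [x_a], [x_b] by
    their conditional mean given the pair, [(p_a x_a + p_b x_b) / (p_a + p_b)].
    This keeps the mean, and by convexity of the square it does not increase
    the variance ([sqr_wmean_le], Rao-Blackwell for a partition into pairs).
    The argument works for every positive probability on the columns
    ([pair_err_le_single_err]); the optimal one is an instance, except that for
    [n = 0] it is not a probability, and then there is no sample at all. *)

(** Independence: the expectation of a product of functions of distinct draws
    is the product of their expectations. *)
Lemma iid_expect_prod (R : realType) (T : finType) (c : nat) (p : T -> R)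
    (g : 'I_c -> T -> R) :
  iid_expect p (fun t : {ffun 'I_c -> T} => \prod_(i < c) g i (t i)) =
  \prod_(i < c) \sum_k p k * g i k.
Proof.
rewrite bigA_distr_bigA /iid_expect.
by apply: eq_bigr => t _; rewrite -big_split.
Qed.

Lemma iid_expect_sum (R : realType) (T J : finType) (c : nat) (p : T -> R)
    (X : J -> {ffun 'I_c -> T} -> R) :
  iid_expect p (fun t => \sum_j X j t) = \sum_j iid_expect p (X j).
Proof.
by rewrite exchange_big; apply: eq_bigr => t _; rewrite mulr_sumr.
Qed.

Lemma iid_expectZ (R : realType) (T : finType) (c : nat) (p : T -> R) (a : R)
    (X : {ffun 'I_c -> T} -> R) :
  iid_expect p (fun t => a * X t) = a * iid_expect p X.
Proof. by rewrite mulr_sumr; apply: eq_bigr => t _; rewrite mulrCA. Qed.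

Lemma eq_iid_expect (R : realType) (T : finType) (c : nat) (p : T -> R)
    (X Y : {ffun 'I_c -> T} -> R) :
  X =1 Y -> iid_expect p X = iid_expect p Y.
Proof. by move=> eqXY; apply: eq_bigr => t _; rewrite eqXY. Qed.

(** Distinct draws of a centred variable are uncorrelated, so only the diagonal
    terms survive when the square of a sample mean is expanded. *)
Lemma iid_expect_cross (R : realType) (T : finType) (c : nat) (p : T -> R)
    (y : T -> R) (i j : 'I_c) :
  \sum_k p k = 1 -> \sum_k p k * y k = 0 ->
  iid_expect p (fun t : {ffun 'I_c -> T} => y (t i) * y (t j)) =
  if i == j then \sum_k p k * y k ^+ 2 else 0.
Proof.
move=> p1 py0.
(* To use independence, write the product as one factor per draw. *)
pose g (h : 'I_c) k := (if h == i then y k else 1) * (if h == j then y k else 1).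
rewrite (@eq_iid_expect _ _ _ _ _ (fun t => \prod_h g h (t h))); last first.
  by move=> t; rewrite big_split /= -!big_mkcond /= !big_pred1_eq.
rewrite iid_expect_prod (bigD1 i) //= /g eqxx.
case: eqVneq => [<-|ij]; last first.
  rewrite (eq_bigr (fun k => p k * y k)) ?py0 ?mul0r // => k _.
  by rewrite mulr1.
rewrite [X in _ * X]big1 ?mulr1 // => h /negPf ->.
by rewrite -[RHS]p1; apply: eq_bigr => k _; rewrite !mulr1.
Qed.

(** The mean squared error of the mean of [c] independent draws is the variance
    of one draw divided by [c]: centre [x] at its mean [mu] and expand the
    square, which leaves [c] equal diagonal terms with the factor [c^-2]. *)
Lemma iid_expect_sample_mean (R : realType) (T : finType) (c : nat)
    (p x : T -> R) (mu : R) :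
  (0 < c)%N -> \sum_k p k = 1 -> \sum_k p k * x k = mu ->
  iid_expect p (fun t : {ffun 'I_c -> T} =>
    (mu - c%:R^-1 * \sum_(i < c) x (t i)) ^+ 2) =
  c%:R^-1 * (\sum_k p k * x k ^+ 2 - mu ^+ 2).
Proof.
move=> c_gt0 p1 pxmu.
have c0 : c%:R != 0 :> R by rewrite pnatr_eq0 -lt0n.
pose y k := x k - mu.
have py0 : \sum_k p k * y k = 0.
  under eq_bigr do rewrite mulrBr.
  by rewrite sumrB -mulr_suml p1 pxmu mul1r subrr.
have py2 : \sum_k p k * y k ^+ 2 = \sum_k p k * x k ^+ 2 - mu ^+ 2.
  rewrite (eq_bigr (fun k => p k * x k ^+ 2 - 2 * mu * (p k * x k)
                             + p k * mu ^+ 2)); last first.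
    by move=> k _; rewrite /y; ring.
  by rewrite big_split sumrB /= -mulr_sumr -mulr_suml p1 pxmu; ring.
rewrite (@eq_iid_expect _ _ _ _ _ (fun t =>
    c%:R^-1 ^+ 2 * \sum_(i < c) \sum_(j < c) y (t i) * y (t j))); last first.
  move=> t; under [in RHS]eq_bigr do rewrite -mulr_sumr.
  rewrite -mulr_suml sumrB sumr_const card_ord -mulr_natr.
  by field.
rewrite iid_expectZ iid_expect_sum.
under eq_bigr => i _.
  rewrite iid_expect_sum.
  under eq_bigr do rewrite iid_expect_cross //.
  rewrite -big_mkcond (eq_bigl (pred1 i)) ?big_pred1_eq; last first.
    by move=> j; rewrite /= eq_sym.
  over.
by rewrite sumr_const card_ord py2 -mulr_natr; field.
Qed.

Lemma frob_sqr (R : realType) (m n : nat) (M : 'M[R]_(m, n)) :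
  frob M ^+ 2 = \sum_i \sum_j M i j ^+ 2.
Proof.
by rewrite sqr_sqrtr // !sumr_ge0 // => i _; rewrite sumr_ge0 // => j _;
  rewrite sqr_ge0.
Qed.

(** Stated for an arbitrary matrix-valued sample [X]: single columns and pairs
    of columns are two instances. *)
Lemma iid_expect_frob (R : realType) (T : finType) (m q c : nat) (p : T -> R)
    (M : 'M[R]_(m, q)) (X : T -> 'M[R]_(m, q)) :
  (0 < c)%N -> \sum_k p k = 1 -> \sum_k p k *: X k = M ->
  iid_expect p (fun t : {ffun 'I_c -> T} =>
    frob (M - c%:R^-1 *: \sum_(i < c) X (t i)) ^+ 2) =
  \sum_i \sum_j c%:R^-1 * (\sum_k p k * X k i j ^+ 2 - M i j ^+ 2).
Proof.
move=> c_gt0 p1 pXM.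
under [LHS]eq_iid_expect do rewrite frob_sqr.
rewrite iid_expect_sum; apply: eq_bigr => i _.
rewrite iid_expect_sum; apply: eq_bigr => j _.
rewrite -(@iid_expect_sample_mean _ _ _ p (fun k => X k i j)) //.
  by apply: eq_iid_expect => t; rewrite !mxE summxE.
by rewrite -pXM summxE; apply: eq_bigr => k _; rewrite mxE.
Qed.

(** Convexity of the square. With [u = p x] and [v = q y], the left side is the
    weight [p + q] times the square of the weighted mean of [x] and [y]. *)
Lemma sqr_wmean_le (R : realType) (p q u v : R) : 0 < p -> 0 < q ->
  (p + q) * ((p + q)^-1 * (u + v)) ^+ 2 <=
  p * (p^-1 * u) ^+ 2 + q * (q^-1 * v) ^+ 2.
Proof.
move=> p0 q0; have pq0 : 0 < p + q by rewrite addr_gt0.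
rewrite -subr_ge0.
have -> : p * (p^-1 * u) ^+ 2 + q * (q^-1 * v) ^+ 2
          - (p + q) * ((p + q)^-1 * (u + v)) ^+ 2 =
          (q * u - p * v) ^+ 2 / (p * q * (p + q)).
  by field; rewrite !gt_eqF.
by rewrite divr_ge0 ?sqr_ge0 // !mulr_ge0 // ltW.
Qed.

Lemma big_nat_double (R : nmodType) (h : nat) (f : nat -> R) :
  \sum_(0 <= i < h.*2) f i = \sum_(0 <= i < h) (f i.*2 + f i.*2.+1).
Proof.
elim: h => [|h IHh]; first by rewrite !big_geq.
by rewrite doubleS !big_nat_recr //= IHh addrA.
Qed.

(** As [n] is even, the positions split into the pairs [2j, 2j+1] with none left
    over, and [I] only permutes the terms. *)
Lemma sum_pairs (R : nmodType) (n : nat) (I : 'I_n -> 'I_n) (F : 'I_n -> R) :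
  ~~ odd n -> bijective I ->
  \sum_l F l = \sum_j (F (I (pair_fst j)) + F (I (pair_snd j))).
Proof.
move=> en bI; rewrite (reindex I) /=; last exact: onW_bij.
(* Positions [2j] and [2j+1] are handled as naturals, with [F \o I] extended
   by 0 outside 'I_n. *)
pose f k := oapp (fun l : 'I_n => F (I l)) 0 (insub k).
have fE (l : 'I_n) : f l = F (I l) by rewrite /f valK.
rewrite (eq_bigr (fun l : 'I_n => f l)) => [|l _]; last by rewrite fE.
rewrite -(big_mkord xpredT f) -[X in index_iota 0 X](even_halfK en).
rewrite big_nat_double big_mkord; apply: eq_bigr => j _.
by rewrite -(fE (pair_fst j)) -(fE (pair_snd j)).
Qed.

Lemma mulmx_col_row (R : realType) (m n q : nat) (A : 'M[R]_(m, n))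
    (B : 'M[R]_(n, q)) (l : 'I_n) i k :
  (col l A *m row l B) i k = A i l * B l k.
Proof. by rewrite mxE big_ord1 !mxE. Qed.

Lemma mulmx_colset_rowset (R : realType) (m n q : nat) (J : {set 'I_n})
    (A : 'M[R]_(m, n)) (B : 'M[R]_(n, q)) :
  colset J A *m rowset J B = \sum_(l in J) col l A *m row l B.
Proof.
apply/matrixP => i k; rewrite mxE summxE [RHS]big_enum_val.
by apply: eq_bigr => l _; rewrite mulmx_col_row !mxE.
Qed.

Lemma mulmx_sum_outer (R : realType) (m n q : nat) (A : 'M[R]_(m, n))
    (B : 'M[R]_(n, q)) :
  \sum_l col l A *m row l B = A *m B.
Proof.
apply/matrixP => i k; rewrite summxE mxE.
by apply: eq_bigr => l _; rewrite mulmx_col_row.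
Qed.

(** Injectivity matters: it makes the index set of a pair have two elements. *)
Lemma mulmx_pair_set (R : realType) (m n q : nat) (I : 'I_n -> 'I_n)
    (A : 'M[R]_(m, n)) (B : 'M[R]_(n, q)) (j : 'I_n./2) : injective I ->
  colset (pair_set I j) A *m rowset (pair_set I j) B =
  col (I (pair_fst j)) A *m row (I (pair_fst j)) B +
  col (I (pair_snd j)) A *m row (I (pair_snd j)) B.
Proof.
move=> injI; rewrite mulmx_colset_rowset big_setU1 ?big_set1 //.
rewrite inE (inj_eq injI); apply/eqP => /(congr1 val) /= /eqP.
by rewrite ltn_eqF.
Qed.

(** Both estimators are unbiased, so the terms [- (A *m B) i k ^+ 2] of their variances
    cancel. What remains are second moments, which compare pair by pair. *)
Lemma pair_err_le_single_err (R : realType) (m n q c : nat)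
    (A : 'M[R]_(m, n)) (B : 'M[R]_(n, q)) (I : 'I_n -> 'I_n) (p : 'I_n -> R) :
  ~~ odd n -> (0 < c)%N -> (forall l, 0 < p l) -> \sum_l p l = 1 ->
  bijective I ->
  iid_expect (ppair I p)
    (fun r : {ffun 'I_c -> 'I_n./2} =>
       frob (A *m B - pair_est I p A B r) ^+ 2)
  <= single_err c p A B.
Proof.
move=> en c_gt0 p0 p1 bI; have injI := bij_inj bI.
have pp0 j : 0 < ppair I p j by rewrite addr_gt0.
rewrite /single_err /single_est /pair_est.
rewrite (@iid_expect_frob _ _ _ _ _ p _
          (fun l => (p l)^-1 *: (col l A *m row l B))) //; last first.
  rewrite -mulmx_sum_outer; apply: eq_bigr => l _.
  by rewrite scalerA mulfV ?scale1r // gt_eqF.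
rewrite (@iid_expect_frob _ _ _ _ _ (ppair I p) _ (fun j => (ppair I p j)^-1 *:
          (colset (pair_set I j) A *m rowset (pair_set I j) B))) //; last 2 first.
- by rewrite -p1 (sum_pairs _ _ _ _ en bI).
- rewrite -mulmx_sum_outer (sum_pairs _ _ _ _ en bI).
  apply: eq_bigr => j _.
  by rewrite scalerA mulfV ?scale1r ?mulmx_pair_set // gt_eqF.
apply: ler_sum => i _; apply: ler_sum => k _.
rewrite ler_wpM2l ?invr_ge0 ?ler0n // lerB //.
rewrite [leRHS](sum_pairs _ _ _ _ en bI); apply: ler_sum => j _.
by rewrite mulmx_pair_set // 3!mxE [X in _ <= X + _]/= !mxE sqr_wmean_le.
Qed.

Lemma sum_popt (R : realType) (m n q : nat) (A : 'M[R]_(m, n))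
    (B : 'M[R]_(n, q)) (l : 'I_n) :
  0 < popt A B l -> \sum_k popt A B k = 1.
Proof.
move=> pl; rewrite -mulr_suml mulfV //.
(* Were the denominator 0, the quotient [popt A B l] would be 0 as well. *)
by apply: contraTneq pl; rewrite /popt => ->; rewrite invr0 mulr0 ltxx.
Qed.

Theorem corollary3p1 (R : realType) (m n q c : nat)
    (A : 'M[R]_(m, n)) (B : 'M[R]_(n, q)) (I : 'I_n -> 'I_n)
    (hn : ~~ odd n) (hc : (1 <= c)%N)
    (hp : forall l : 'I_n, 0 < popt A B l)
    (hI : bijective I) :
  iid_expect (ppair I (popt A B))
    (fun r : {ffun 'I_c -> 'I_n./2} =>
       frob (A *m B - pair_est I (popt A B) A B r) ^+ 2)
  <= single_err c (popt A B) A B.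
Proof.
case: (posnP n) => [n0 | n_gt0]; last first.
  exact: pair_err_le_single_err (sum_popt _ _ _ _ _ _ _ (hp (Ordinal n_gt0))) _.
(* For [n = 0] both expectations are sums over no samples at all. *)
rewrite /single_err /iid_expect !big1 // => t.
  by have := ltn_ord (t (Ordinal hc)); rewrite [X in (_ < X)%N]n0.
by have := ltn_ord (t (Ordinal hc)); rewrite [X in (_ < X./2)%N]n0.
Qed.
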